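(* Let $X=S^1$ be the circle, and let $p:E\to S^1$ be a nontrivial covering map (for example, the standard double covering $p:S^1\to S^1$, $p(z)=z^2$). Let $A$ be the sheaf of local sections of $p$, i.e. for each open set $U\subseteq S^1$, $$A(U)=\{\, s:U\to E \text{ continuous} \mid p\circ s=\mathrm{id}_U \,\},$$ with the evident restriction maps. Then $A$ is internally inhabited in the topos $\mathbf{Sh}(S^1)$ of sheaves of sets on $S^1$, but $A$ has no global section, i.e. there is no morphism $1\to A$ in $\mathbf{Sh}(S^1)$.
   Context: $\mathbf{Sh}(S^1)$ denotes the topos of sheaves of sets on the topological space $S^1$, and $1$ denotes its terminal object. A global element (global name) of an object $A$ of a topos is a morphism $1\to A$; for a sheaf this is the same as a global section. An object $A$ of a topos $\mathcal{E}$ is internally inhabited if the statement $\exists a{:}A.\,\top$ holds in the internal logic of $\mathcal{E}$; equivalently, the unique morphism $!_A:A\to 1$ is an epimorphism. Here the existential quantifier along a projection $\pi$ is interpreted as the left adjoint $\exists_\pi$ of the pullback functor $\pi^*$ on subobjects.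
   Formalization: ''Nontrivial covering'' is taken to mean that no connected component of E is a trivial covering of the circle (same as nontrivial if E is connected); otherwise the claim fails, e.g. for the disjoint union of the identity and z^2, which is not a product but has a global section. *)

(* Defs.v *)
From HB Require Import structures.
From mathcomp Require Import all_boot all_order all_algebra.
From mathcomp Require Import all_classical all_reals topology normedtype.
From mathcomp Require Import ring.
Set Implicit Arguments.
Unset Strict Implicit.
Unset Printing Implicit Defensive.
Import Order.TTheory GRing.Theory Num.Theory.
Import numFieldNormedType.Exports.

Local Open Scope classical_set_scope.
Local Open Scope ring_scope.

(* A set used as a type is the subspace: set_type carries the initial topology
   of its inclusion set_val into the ambient space. *)
Definition set_incl (T : Type) (V U : set T) (VU : V `<=` U) (x : V) : U :=
  exist _ (set_val x) (mem_set (VU _ (set_valP x))).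

Lemma set_inclK (T : Type) (V U : set T) (VU : V `<=` U) (x : V) :
  set_val (set_incl VU x) = set_val x.
Proof. by []. Qed.

Lemma set_val_inj (T : Type) (U : set T) (x y : U) :
  set_val x = set_val y -> x = y.
Proof. by move=> xy; apply: val_inj; rewrite -set_valE. Qed.

Lemma continuous_set_val_factor (S T : topologicalType) (U : set T)
    (f : S -> U) : continuous (set_val \o f) -> continuous f.
Proof.
move=> cf x W [_ [ [O oO <-]] Ofx] sW.
apply: filterS sW _; apply: (cf x); exact: open_nbhs_nbhs.
Qed.

Lemma continuous_set_incl (T : topologicalType) (V U : set T)
    (VU : V `<=` U) : continuous (set_incl VU).
Proof.
apply: continuous_set_val_factor.
have -> : set_val \o set_incl VU = set_val by apply/funext.
exact: initial_continuous.
Qed.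

(** ** Sheaves of sets on a topological space *)

Record opens (X : topologicalType) :=
  Opens { opens_set :> set X ; opens_open : open opens_set }.

Record sheaf (X : topologicalType) := Sheaf {
  sections :> opens X -> Type ;
  res : forall U V : opens X, V `<=` U -> sections U -> sections V ;
  res_id : forall (U : opens X) (UU : U `<=` U) (s : sections U),
    res UU s = s ;
  res_comp : forall (U V W : opens X) (VU : V `<=` U) (WV : W `<=` V)
    (WU : W `<=` U) (s : sections U), res WV (res VU s) = res WU s ;
  glue : forall (U : opens X) (I : Type) (V : I -> opens X)
    (VU : forall i, V i `<=` U), U `<=` \bigcup_i V i ->
    forall s : forall i, sections (V i),
    (forall i j (W : opens X) (WVi : W `<=` V i) (WVj : W `<=` V j),
       res WVi (s i) = res WVj (s j)) ->
    exists! t : sections U, forall i, res (VU i) t = s i }.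

Arguments res {X} s {U V} VU t : rename.

Record sheaf_hom (X : topologicalType) (A B : sheaf X) := SheafHom {
  hom_fun :> forall U : opens X, A U -> B U ;
  hom_nat : forall (U V : opens X) (VU : V `<=` U) (s : A U),
    hom_fun (res A VU s) = res B VU (hom_fun s) }.

Program Definition sheaf_one (X : topologicalType) : sheaf X :=
  @Sheaf X (fun=> unit) (fun _ _ _ _ => tt) _ _ _.
Next Obligation. by move=> X U UU []. Qed.
Next Obligation. by []. Qed.
Next Obligation.
by move=> X U I V VU UV s _; exists tt; split=> [i|[] //]; case: (s i).
Qed.

Definition to_one (X : topologicalType) (A : sheaf X) :
  sheaf_hom A (sheaf_one X) :=
  @SheafHom X A (sheaf_one X) (fun _ _ => tt) (fun _ _ _ _ => erefl).

Lemma sheaf_one_terminal (X : topologicalType) (A : sheaf X)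
  (f : sheaf_hom A (sheaf_one X)) : f = to_one A.
Proof.
case: f => f fN; rewrite /to_one.
have E : f = (fun _ _ => tt).
  by apply: functional_extensionality_dep => U; apply: funext => s; case: (f U s).
by move: fN; rewrite E => fN; congr SheafHom; exact: Prop_irrelevance.
Qed.

Definition global_element (X : topologicalType) (A : sheaf X) :=
  sheaf_hom (sheaf_one X) A.

(** ** Subobjects and the existential quantifier *)

(* Every subobject of A in Sh(X) has a unique representative of this form. *)
Record subsheaf (X : topologicalType) (A : sheaf X) := Subsheaf {
  sub_set :> forall U : opens X, set (A U) ;
  sub_res : forall (U V : opens X) (VU : V `<=` U) (s : A U),
    sub_set s -> sub_set (res A VU s) ;
  sub_local : forall (U : opens X) (I : Type) (V : I -> opens X)
    (VU : forall i, V i `<=` U), U `<=` \bigcup_i V i ->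
    forall s : A U, (forall i, sub_set (res A (VU i) s)) -> sub_set s }.

Definition sub_le (X : topologicalType) (A : sheaf X) (S T : subsheaf A) :=
  forall U : opens X, S U `<=` T U.

Definition sub_top (X : topologicalType) (A : sheaf X) : subsheaf A :=
  @Subsheaf X A (fun=> setT) (fun _ _ _ _ _ => I) (fun _ _ _ _ _ _ _ => I).

Program Definition sub_pullback (X : topologicalType) (A B : sheaf X)
    (f : sheaf_hom A B) (T : subsheaf B) : subsheaf A :=
  @Subsheaf X A (fun U => [set s | T U (f U s)]) _ _.
Next Obligation.
by move=> X A B f T U V VU s /=; rewrite hom_nat; exact: sub_res.
Qed.
Next Obligation.
move=> X A B f T U I V VU UV s sT.
apply: (@sub_local X B T U I V VU) => // i; rewrite -hom_nat; exact: sT.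
Qed.

(* The left adjoint of sub_pullback f : Sub(B) -> Sub(A), see
   sub_existsP: Sub(B) is a complete lattice, and the left adjoint maps S to
   the least T with S <= f^* T. *)
Program Definition sub_exists (X : topologicalType) (A B : sheaf X)
    (f : sheaf_hom A B) (S : subsheaf A) : subsheaf B :=
  @Subsheaf X B (fun U => [set t | forall T : subsheaf B,
    sub_le S (sub_pullback f T) -> T U t]) _ _.
Next Obligation.
by move=> X A B f S U V VU t tS T ST; apply: sub_res; exact: tS.
Qed.
Next Obligation.
move=> X A B f S U I V VU UV t tS T ST.
by apply: (@sub_local X B T U I V VU) => // i; exact: tS.
Qed.

Lemma sub_existsP (X : topologicalType) (A B : sheaf X) (f : sheaf_hom A B)
    (S : subsheaf A) (T : subsheaf B) :
  sub_le (sub_exists f S) T <-> sub_le S (sub_pullback f T).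
Proof.
split=> [ST U s Ss|ST U t]; last exact.
by apply: ST => T' ST'; exact: ST'.
Qed.

(* The interpretation of the closed formula "exists a : A, True" is the
   subobject of 1 obtained by quantifying along A -> 1; the formula holds when
   this subobject is all of 1. *)
Definition internally_inhabited (X : topologicalType) (A : sheaf X) :=
  sub_le (sub_top (sheaf_one X)) (sub_exists (to_one A) (sub_top A)).

(** ** The sheaf of local sections of a map *)

Definition local_section (E X : topologicalType) (p : E -> X) (U : set X) :=
  {s : U -> E | continuous s /\ p \o s = set_val}.

Section SectionSheaf.
Variables (E X : topologicalType) (p : E -> X).

Lemma local_section_eq (U : set X) (s t : local_section p U) :
  sval s =1 sval t -> s = t.
Proof.
by case: s t => s ps [t pt] /= /funext st; subst t; congr exist;
  exact: Prop_irrelevance.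
Qed.

Definition local_section_res (U V : opens X) (VU : V `<=` U)
  (s : local_section p U) : local_section p V.
Proof.
exists (sval s \o set_incl VU); case: s => s [cs ps] /=; split.
  move=> x; apply: continuous_comp; [exact: continuous_set_incl|exact: cs].
by apply/funext => x /=; rewrite -[p _]/((p \o s) _) ps.
Defined.

Lemma local_section_glue (U : opens X) (I : Type) (V : I -> opens X)
    (VU : forall i, V i `<=` U) (UV : U `<=` \bigcup_i V i)
    (s : forall i, local_section p (V i)) :
  (forall i j (W : opens X) (WVi : W `<=` V i) (WVj : W `<=` V j),
     local_section_res WVi (s i) = local_section_res WVj (s j)) ->
  exists! t : local_section p U, forall i, local_section_res (VU i) t = s i.
Proof.
move=> sE.
have sV i j (x : V i) (y : V j) : set_val x = set_val y ->
    sval (s i) x = sval (s j) y.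
  move=> xy.
  have oW : open (V i `&` V j) by apply: openI; exact: opens_open.
  have Wx : (V i `&` V j) (set_val x).
    by split; [exact: set_valP|rewrite xy; exact: set_valP].
  have := congr1 (fun t : local_section p _ =>
    sval t (exist _ (set_val x) (mem_set Wx)))
    (sE i j (Opens oW) (@subIsetl _ _ _) (@subIsetr _ _ _)).
  move=> /= e; transitivity (sval (s i)
    (set_incl (@subIsetl _ (V i) (V j)) (exist _ (set_val x) (mem_set Wx)))).
    by congr (sval (s i) _); apply: set_val_inj.
  by rewrite e; congr (sval (s j) _); apply: set_val_inj.
have cov (x : U) : exists iy : {i & V i}, set_val (projT2 iy) = set_val x.
  have [i _ Vx] := UV _ (set_valP x).
  by exists (existT _ i (exist _ (set_val x) (mem_set Vx))).
pose c x := projT1 (cid (cov x)).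
have cE x : set_val (projT2 (c x)) = set_val x by rewrite /c; case: cid.
pose t x := sval (s (projT1 (c x))) (projT2 (c x)).
have tE i (y : V i) : t (set_incl (VU i) y) = sval (s i) y.
  by apply: sV; rewrite cE.
have ct : continuous t.
  move=> x N Ntx; pose i := projT1 (c x); pose y := projT2 (c x).
  have [cs _] := proj2_sig (s i).
  have [_ [ [O oO <-] Oy] sO] := cs y N Ntx.
  exists (set_val @^-1` (O `&` V i)); split => /=.
  - by exists (O `&` V i) => //; apply: openI => //; exact: opens_open.
  - by rewrite -(cE x); split; [exact: Oy|exact: set_valP].
  move=> z [Oz Vz]; pose z' : V i := exist _ (set_val z) (mem_set Vz).
  have -> : z = set_incl (VU i) z' by apply: set_val_inj.
  by rewrite /= tE; apply: sO.
have pt : p \o t = set_val.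
  apply/funext => x; rewrite -cE /t /=.
  by case: (s _) => /= f [_ pf]; rewrite -pf.
exists (exist _ t (conj ct pt)); split => [i|t' t'E].
  by apply: local_section_eq => y; exact: tE.
apply: local_section_eq => x /=; rewrite /t -(t'E _) /=.
by congr (sval t' _); apply: set_val_inj; rewrite set_inclK cE.
Qed.

Lemma local_section_res_id (U : opens X) (UU : U `<=` U)
  (s : local_section p U) : local_section_res UU s = s.
Proof.
by apply: local_section_eq => x /=; congr (sval s _); apply: set_val_inj.
Qed.

Lemma local_section_res_comp (U V W : opens X) (VU : V `<=` U)
    (WV : W `<=` V) (WU : W `<=` U) (s : local_section p U) :
  local_section_res WV (local_section_res VU s) = local_section_res WU s.
Proof.
by apply: local_section_eq => x /=; congr (sval s _); apply: set_val_inj.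
Qed.

Definition section_sheaf : sheaf X :=
  @Sheaf X (fun U => local_section p U) local_section_res
    local_section_res_id local_section_res_comp local_section_glue.

End SectionSheaf.

(** ** Covering maps *)

Definition homeomorphism (S T : topologicalType) (h : S -> T) :=
  exists g : T -> S, [/\ cancel h g, cancel g h, continuous h & continuous g].

(* p restricts to a map D -> U that is isomorphic over U to the projection
   U x F -> U for some discrete space F. *)
Definition trivial_over (E X : topologicalType) (p : E -> X)
    (D : set E) (U : set X) :=
  exists (F : discreteTopologicalType) (h : D -> (U * F)%type),
    homeomorphism h /\ forall e, set_val (h e).1 = p (set_val e).

Definition covering_map (E X : topologicalType) (p : E -> X) :=
  [/\ continuous p, (forall x, exists e, p e = x) &
      forall x, exists U : set X,
        [/\ open U, U x & trivial_over p (p @^-1` U) U]].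

Definition trivial_covering (E X : topologicalType) (p : E -> X) :=
  trivial_over p [set: E] [set: X].

(* For a connected total space this is the negation of trivial_covering
   (nontrivial_covering_connected). A covering that is not trivial as a whole
   may still contain a trivial component, hence a global section (e.g. the
   disjoint union of the identity and of the double covering of the circle), so
   a disconnected covering is required to have no trivial component. *)
Definition nontrivial_covering (E X : topologicalType) (p : E -> X) :=
  forall e : E, ~ trivial_over p (connected_component [set: E] e) [set: X].

Lemma nontrivial_covering_connected (E X : topologicalType) (p : E -> X) :
  connected [set: E] -> [set: E] !=set0 ->
  nontrivial_covering p <-> ~ trivial_covering p.
Proof.
move=> cE [e0 _]; rewrite /nontrivial_covering /trivial_covering.
by split=> [/(_ e0)|nt e]; rewrite connected_component_id.
Qed.

(** ** The circle and its standard double covering *)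

Definition unit_circle (R : realType) : set (R * R) :=
  [set z | z.1 ^+ 2 + z.2 ^+ 2 = 1].
Arguments unit_circle R : clear implicits.

Definition circle (R : realType) : topologicalType := set_type (unit_circle R).

Lemma unit_circle_sq (R : realType) (z : unit_circle R) :
  unit_circle R ((set_val z).1 ^+ 2 - (set_val z).2 ^+ 2,
                 2 * (set_val z).1 * (set_val z).2).
Proof.
have := set_valP z; rewrite set_valE; case: z => -[x y] _ /= xy.
rewrite /unit_circle /=; transitivity ((x ^+ 2 + y ^+ 2) ^+ 2); first by ring.
by rewrite xy expr1n.
Qed.

(* z |-> z^2, where (x, y) stands for the complex number x + i y. *)
Definition circle_sq (R : realType) (z : circle R) : circle R :=
  exist (fun w => w \in unit_circle R) _ (mem_set (unit_circle_sq z)).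

(* Main.v *)
(* A covering has local sections, and existence in a sheaf topos is local, so
   the sheaf of sections is internally inhabited. A global section s of a
   covering of a connected space has a connected, open and closed image, which
   is thus a component of the total space mapped homeomorphically onto the base:
   a trivial component. The squaring map of the circle has a connected total
   space and is not injective, so it is not trivial. *)
Require Import Defs.
From mathcomp Require Import all_boot all_order all_algebra.
From mathcomp Require Import all_classical all_reals topology normedtype.
From mathcomp Require Import realfun ring lra.

Set Implicit Arguments.
Unset Strict Implicit.
Unset Printing Implicit Defensive.
Import Order.TTheory GRing.Theory Num.Theory.
Import numFieldNormedType.Exports.

Local Open Scope classical_set_scope.
Local Open Scope ring_scope.

(** * Subspaces, products and discrete spaces *)

Definition set_point (T : Type) (U : set T) (x : T) (Ux : U x) : U :=
  exist _ x (mem_set Ux).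
Arguments set_point {T U} & x Ux.

Lemma continuous_set_val (T : topologicalType) (U : set T) :
  continuous (set_val : U -> T).
Proof. exact: initial_continuous. Qed.

(** Carries a property established near a point of a chart domain over to the total space. *)
Lemma set_val_image_nbhs (T : topologicalType) (U : set T) (x : U)
    (N : set U) : open U -> nbhs x N -> nbhs (set_val x) (set_val @` N).
Proof.
move=> oU [_ [[O oO <-] Ox ON]].
apply: (@filterS _ _ _ (O `&` U)).
  by move=> y [Oy Uy]; exists (set_point y Uy) => //; exact: ON.
by apply: open_nbhs_nbhs; split; [exact: openI|split=> //; exact: set_valP].
Qed.

Lemma homeomorphism_continuous (S T : topologicalType) (h : S -> T) :
  homeomorphism h -> continuous h.
Proof. by case=> g []. Qed.

Lemma homeomorphism_inj (S T : topologicalType) (h : S -> T) :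
  homeomorphism h -> injective h.
Proof. by case=> g [hK _ _ _]; exact: can_inj hK. Qed.

Lemma continuous_discrete_nbhs (S : topologicalType)
    (F : discreteTopologicalType) (f : S -> F) (x : S) :
  continuous f -> nbhs x [set y | f y = f x].
Proof. by move=> cf; exact: (cf x _ (discrete_set1 (f x))). Qed.

Lemma continuous_fst (S T : topologicalType) : continuous (@fst S T).
Proof. by move=> x; exact: cvg_fst. Qed.

Lemma continuous_snd (S T : topologicalType) : continuous (@snd S T).
Proof. by move=> x; exact: cvg_snd. Qed.

Lemma continuous_pair (S T U : topologicalType) (f : S -> T) (g : S -> U) :
  continuous f -> continuous g -> continuous (fun x => (f x, g x)).
Proof. by move=> cf cg x; exact: cvg_pair (cf x) (cg x). Qed.

(** In a discrete codomain singletons are clopen, so the fibre of [f] through [x] is a nonempty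
    clopen subset of a connected space. *)
Lemma continuous_locally_constant (X : topologicalType)
    (F : discreteTopologicalType) (f : X -> F) (x y : X) :
  connected [set: X] -> continuous f -> f y = f x.
Proof.
move=> cX /continuousP cf.
pose B := f @^-1` [set f x].
have -> : f y = f x <-> B y by [].
suff -> : B = setT by [].
apply: cX; first by exists x.
  by exists B; rewrite ?setTI//; apply: cf; exact: discrete_open.
exists B; rewrite ?setTI//.
by rewrite -openC preimage_setC; apply: cf; exact: discrete_open.
Qed.

(** * Local and global sections of a covering *)

Section Covering.
Variables (E X : topologicalType) (p : E -> X).

(** The section is the sheet through [e]: the discrete coordinate is frozen at that of [e] and the
    chart is inverted. *)
Lemma trivial_over_section (U : set X) (e : E) :
  U (p e) -> trivial_over p (p @^-1` U) U ->
  exists s : U -> E, continuous s /\ p \o s = set_val.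
Proof.
move=> Upe [F [h [[g [hK gK _ cg]] ph]]].
pose d : p @^-1` U := set_point e Upe.
exists (fun x => set_val (g (x, (h d).2))); split.
  move=> x; apply: continuous_comp; last exact: continuous_set_val.
  apply: (@continuous_comp _ _ _ (fun x => (x, (h d).2)) g); last exact: cg.
  by apply: continuous_pair; [move=> y; exact: cvg_id|exact: cst_continuous].
by apply/funext => x /=; rewrite -ph gK.
Qed.

(** By the definition of [sub_exists], [tt] over [U] must lie in every subsheaf [T] of 1 whose
    pullback is everything. Such a [T] contains [tt] over each open set that carries a section, and
    these sets cover the base. *)
Lemma covering_internally_inhabited :
  covering_map p -> internally_inhabited (section_sheaf p).
Proof.
move=> [cp sp tp] U [] _ T TP.
have loc (x : X) : exists V : opens X,
    (V : set X) x /\ exists s : V -> E, continuous s /\ p \o s = set_val.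
  have [V [oV Vx tV]] := tp x; have [e pe] := sp x.
  exists (Opens oV); split=> //.
  by apply: (@trivial_over_section V e) => //; rewrite pe.
pose V (x : X) := sval (cid (loc x)).
have oW x : open (U `&` V x) by apply: openI; exact: opens_open.
(* [U] is covered by the sets [U] ∩ [V x]; membership in [T] over such a set is restricted from
   [V x], where a section exists. *)
apply: (@sub_local _ _ T U X (fun x => Opens (oW x))
  (fun x => @subIsetl _ _ _)) => /= [x Ux|x].
  by exists x => //; split=> //; rewrite /V; case: cid => ? [].
have := svalP (cid (loc x)); rewrite -/(V x) => -[_ [s cs]].
have := @sub_res _ _ T (V x) (Opens (oW x)) (@subIsetr _ _ _) tt.
by apply; exact: (TP (V x) (exist _ s cs) I).
Qed.

Section GlobalSection.
Variable s : X -> E.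
Hypotheses (cs : continuous s) (ps : cancel s p).

(* In a chart over U, e is in the image of s iff the discrete coordinates of e
   and of s (p e) agree, and both are locally constant in e. *)
Lemma section_range_locally_constant (e0 : E) : covering_map p ->
  \forall e \near e0, range s e <-> range s e0.
Proof.
move=> [cp _ /(_ (p e0)) [U [oU Up [F [h [hh hp]]]]]].
have ch := homeomorphism_continuous hh.
have oD : open (p @^-1` U) by move/continuousP: cp; apply.
have sD (d : p @^-1` U) : (p @^-1` U) (s (p (set_val d))).
  by rewrite /preimage/= ps; exact: (set_valP d).
(* [sp] moves a point to the value of the section in the same fibre, so the image of [s] consists of
   its fixed points. As [sp] preserves [p], the charts of a point and of its image can differ only
   in the discrete coordinate. *)
pose sp (d : p @^-1` U) : p @^-1` U :=
  set_point (s (p (set_val d))) (sD d).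
have csp : continuous sp.
  apply: continuous_set_val_factor => d.
  apply: (@continuous_comp _ _ _ (p \o set_val) s); last exact: cs.
  by apply: continuous_comp; [exact: continuous_set_val|exact: cp].
have chsp : continuous (h \o sp).
  by move=> d; apply: continuous_comp; [exact: csp|exact: ch].
have rangeE (d : p @^-1` U) :
    range s (set_val d) <-> (h (sp d)).2 = (h d).2.
  split=> [[x _ xd]|hd]; first by congr (h _).2; apply: set_val_inj;
    rewrite -[LHS]/(s (p (set_val d))) -xd ps.
  exists (p (set_val d)) => //; rewrite -[LHS]/(set_val (sp d)).
  congr set_val; apply: (homeomorphism_inj hh).
  rewrite [LHS]surjective_pairing [RHS]surjective_pairing hd; congr pair.
  by apply: set_val_inj; rewrite !hp /= ps.
pose d0 : p @^-1` U := set_point e0 Up.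
have N1 : nbhs d0 [set d | (h d).2 = (h d0).2].
  apply: (@continuous_discrete_nbhs _ _ (snd \o h)) => d.
  by apply: continuous_comp; [exact: ch|exact: continuous_snd].
have N2 : nbhs d0 [set d | (h (sp d)).2 = (h (sp d0)).2].
  apply: (@continuous_discrete_nbhs _ _ (snd \o (h \o sp))) => d.
  by apply: continuous_comp; [exact: chsp|exact: continuous_snd].
apply: filterS (set_val_image_nbhs oD (filterI N1 N2)) => _ [d [/= hd hsd] <-].
apply: iff_trans (rangeE d) _; rewrite hd hsd; exact: iff_sym (rangeE d0).
Qed.

Lemma section_range_clopen : covering_map p -> clopen (range s).
Proof.
move=> cp; split.
  rewrite openE => e se.
  by apply: filterS (section_range_locally_constant e cp) => e' [_]; apply.
rewrite -openC openE => e se.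
apply: filterS (section_range_locally_constant e cp) => e' [+ _] e's.
by move=> /(_ e's).
Qed.

Lemma section_range_component (x : X) : connected [set: X] -> covering_map p ->
  connected_component [set: E] (s x) = range s.
Proof.
move=> cX cp; have [oS clS] := section_range_clopen cp.
apply/seteqP; split; last first.
  apply: connected_component_max; [exact: imageT|by []|].
  apply: connected_continuous_connected => //.
  exact: continuous_subspaceT.
(* Conversely, the component meets the image in a nonempty subset that is relatively open and
   closed, hence in the whole component. *)
apply/setIidPl; apply: component_connected.
- exists (s x); split; last by exists x.
  exact: connected_component_refl.
- by exists (range s).
- by exists (range s).
Qed.

Lemma section_range_trivial :
  continuous p -> trivial_over p (range s) [set: X].
Proof.
(* The image has one point over each base point, so the fibre is a singleton; the inverse of the
   chart is [s] itself. *)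
move=> cp; exists (discrete_topology unit).
exists (fun d => (set_point (p (set_val d)) I, tt)); split => //.
have sr (y : [set: X] * discrete_topology unit) : range s (s (set_val y.1)).
  by exists (set_val y.1).
exists (fun y => set_point (s (set_val y.1)) (sr y)); split.
- move=> d; apply: set_val_inj; rewrite -[LHS]/(s (p (set_val d))).
  by have [x _] := set_valP d; rewrite -set_valE => <-; rewrite ps.
- move=> [y []]; congr pair; apply: set_val_inj => /=; exact: ps.
- apply: continuous_pair; last exact: cst_continuous.
  apply: (@continuous_set_val_factor _ _ _
    (fun d : range s => set_point (p (set_val d)) I : [set: X])) => d.
  by apply: (@continuous_comp _ _ _ set_val p); [exact: continuous_set_val|exact: cp].
- apply: continuous_set_val_factor => y.
  apply: (@continuous_comp _ _ _ (set_val \o fst) s); last exact: cs.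
  by apply: continuous_comp; [exact: continuous_fst|exact: continuous_set_val].
Qed.

End GlobalSection.

(** Evaluate at the whole space. The result is a section on the subspace [[set: X]], which is then
    transported along the identification [i] of [X] with that subspace. *)
Lemma global_element_section : global_element (section_sheaf p) ->
  exists2 s : X -> E, continuous s & cancel s p.
Proof.
move=> f; case: (f (Opens openT) tt) => s [cs ps].
pose i (x : X) : [set: X] := set_point x I.
exists (s \o i) => [x|x]; last by rewrite -[LHS]/((p \o s) (i x)) ps.
apply: continuous_comp; last exact: cs.
by apply: (continuous_set_val_factor (f := i)) => y; exact: cvg_id.
Qed.

Lemma nontrivial_no_global_element : inhabited X -> connected [set: X] ->
  covering_map p -> nontrivial_covering p ->
  ~ inhabited (global_element (section_sheaf p)).
Proof.
move=> [x] cX cp np [/global_element_section[s cs ps]].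
apply: (np (s x)); rewrite section_range_component//.
by apply: section_range_trivial => //; case: cp.
Qed.

End Covering.

(** On a connected total space the discrete coordinate is constant, so the injective chart depends
    only on [p]. *)
Lemma trivial_covering_inj (E X : topologicalType) (p : E -> X) :
  connected [set: E] -> trivial_covering p -> injective p.
Proof.
move=> cE [F [h [hh hp]]] x y pxy.
pose i (e : E) : [set: E] := set_point e I.
have chi : continuous (snd \o (h \o i)).
  move=> e; apply: continuous_comp; last exact: continuous_snd.
  apply: continuous_comp; last exact: homeomorphism_continuous.
  by apply: (continuous_set_val_factor (f := i)) => z; exact: cvg_id.
suff /(homeomorphism_inj hh)/(congr1 set_val) : h (i x) = h (i y) by [].
rewrite [LHS]surjective_pairing [RHS]surjective_pairing; congr pair.
  by apply: set_val_inj; rewrite !hp.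
exact: (continuous_locally_constant _ _ cE chi).
Qed.

(** * Continuity of real-valued functions *)

Section RealFunctions.
Variables (R : realType) (T : topologicalType).
Implicit Types f g : T -> R.

Lemma continuous_add f g :
  continuous f -> continuous g -> continuous (fun x => f x + g x).
Proof. by move=> cf cg x; exact: continuousD (cf x) (cg x). Qed.

Lemma continuous_sub f g :
  continuous f -> continuous g -> continuous (fun x => f x - g x).
Proof. by move=> cf cg x; exact: continuousB (cf x) (cg x). Qed.

Lemma continuous_mul f g :
  continuous f -> continuous g -> continuous (fun x => f x * g x).
Proof. by move=> cf cg x; exact: continuousM (cf x) (cg x). Qed.

Lemma continuous_inv f : (forall x, f x != 0) ->
  continuous f -> continuous (fun x => (f x)^-1).
Proof. by move=> f0 cf x; exact: continuousV (f0 x) (cf x). Qed.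

(** The codomain is the discrete space [bool]: the sign is locally constant because both open
    half-lines have open preimages. *)
Lemma continuous_positive f : (forall x, f x != 0) ->
  continuous f -> continuous (fun x => 0 < f x).
Proof.
move=> f0 cf x; apply/discrete_cvg.
have [fp|fn|fx] := ltrgt0P (f x); last by have := f0 x; rewrite fx eqxx.
  have N : nbhs x (f @^-1` [set r | 0 < r]).
    by apply: cf; apply: open_nbhs_nbhs; split; [exact: open_gt|].
  by apply: (filterS _ N) => y /= ->.
have N : nbhs x (f @^-1` [set r | r < 0]).
  by apply: cf; apply: open_nbhs_nbhs; split; [exact: open_lt|].
apply: (filterS _ N) => y /= fy.
by apply/negbTE; rewrite -leNgt ltW.
Qed.

End RealFunctions.

(** * The squaring map of the circle *)

Section Circle.
Variable R : realType.
Implicit Types (z w : circle R) (b : bool).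

Definition re z : R := (set_val z).1.
Definition im z : R := (set_val z).2.

Lemma circle_norm z : re z ^+ 2 + im z ^+ 2 = 1.
Proof. by have := set_valP z; rewrite -set_valE. Qed.

Lemma circle_norm_im z : im z ^+ 2 = 1 - re z ^+ 2.
Proof. by rewrite -(circle_norm z) addrAC subrr add0r. Qed.

Lemma circle_eq z w : re z = re w -> im z = im w -> z = w.
Proof.
move=> r i; apply: set_val_inj.
by rewrite [LHS]surjective_pairing [RHS]surjective_pairing; congr pair.
Qed.

Definition circle_pt (x y : R) (xy : unit_circle R (x, y)) : circle R :=
  set_point (x, y) xy.

Lemma re_pt x y (xy : unit_circle R (x, y)) : re (circle_pt xy) = x.
Proof. by []. Qed.

Lemma im_pt x y (xy : unit_circle R (x, y)) : im (circle_pt xy) = y.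
Proof. by []. Qed.

Lemma continuous_re : continuous re.
Proof.
move=> z; apply: (@continuous_comp _ _ _ (set_val : circle R -> _) fst).
  exact: continuous_set_val.
exact: continuous_fst.
Qed.

Lemma continuous_im : continuous im.
Proof.
move=> z; apply: (@continuous_comp _ _ _ (set_val : circle R -> _) snd).
  exact: continuous_set_val.
exact: continuous_snd.
Qed.

Lemma continuous_to_circle (S : topologicalType) (f : S -> circle R) :
  continuous (re \o f) -> continuous (im \o f) -> continuous f.
Proof.
move=> cr ci; apply: continuous_set_val_factor.
have -> : set_val \o f = (fun s => ((re \o f) s, (im \o f) s)).
  by apply/funext => s; rewrite [LHS]surjective_pairing.
exact: continuous_pair.
Qed.

Lemma re_sq z : re (circle_sq z) = re z ^+ 2 - im z ^+ 2.
Proof. by []. Qed.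

Lemma im_sq z : im (circle_sq z) = 2 * re z * im z.
Proof. by []. Qed.

(** * Connectedness of the circle *)

Lemma rational_circle_subproof (e : bool) (t : R) : unit_circle R
  ((-1) ^+ e * (1 - t ^+ 2) / (1 + t ^+ 2), 2 * t / (1 + t ^+ 2)).
Proof.
have t0 : 1 + t ^+ 2 != 0 by apply: lt0r_neq0; nra.
by rewrite /unit_circle /=; case: e; rewrite ?expr1 ?expr0; field.
Qed.

(** Inverse stereographic projection, from (-1, 0) if [e] is [false] and from (1, 0) if [e] is
    [true]. *)
Definition rational_circle (e : bool) (t : R) : circle R :=
  circle_pt (rational_circle_subproof e t).

Lemma continuous_rational_circle e : continuous (rational_circle e).
Proof.
have c2 : continuous (fun t : R => t ^+ 2) by exact: exprn_continuous.
have ci : continuous (fun t : R => (1 + t ^+ 2)^-1).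
  apply: continuous_inv => [t|]; first by apply: lt0r_neq0; nra.
  by apply: continuous_add; [exact: cst_continuous|exact: c2].
apply: continuous_to_circle.
  apply: continuous_mul; last exact: ci.
  apply: continuous_mul; first exact: cst_continuous.
  by apply: continuous_sub; [exact: cst_continuous|exact: c2].
apply: continuous_mul; last exact: ci.
by apply: continuous_mul; [exact: cst_continuous|move=> t; exact: cvg_id].
Qed.

(** The hypothesis says that [z] is not the centre of projection. The parameter is then im z / (1 ±
    re z), up to sign the slope of the line joining [z] to that centre. *)
Lemma rational_circle_range (e : bool) z :
  1 + (-1) ^+ e * re z != 0 -> range (rational_circle e) z.
Proof.
set u := 1 + _ => u0; exists (im z / u) => //.
have xE : re z = (-1) ^+ e * (u - 1).
  by rewrite /u addrAC subrr add0r signrMK.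
have tE : (im z / u) ^+ 2 = (2 - u) / u.
  have -> : (im z / u) ^+ 2 = (1 - re z ^+ 2) / u ^+ 2.
    by rewrite -circle_norm_im expr_div_n.
  by rewrite xE exprMn sqrr_sign; field.
have u2 : u + (2 - u) != 0 by rewrite addrC subrK pnatr_eq0.
by apply: circle_eq; rewrite ?re_pt ?im_pt tE ?xE; field; rewrite u0.
Qed.

Lemma connected_circle : connected [set: circle R].
Proof.
have -> : [set: circle R] =
    range (rational_circle false) `|` range (rational_circle true).
  apply/seteqP; split=> // z _; have [e|e] := eqVneq (1 + re z) 0.
    right; apply: rational_circle_range; rewrite expr1.
    by apply: lt0r_neq0; lra.
  by left; apply: rational_circle_range; rewrite expr0 mul1r.
have c e : connected (range (rational_circle e)).
  apply: connected_continuous_connected; first exact/connected_intervalP.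
  apply: continuous_subspaceT; exact: continuous_rational_circle.
apply: connectedU; [|exact: c|exact: c].
(* Both parametrisations send 1 to (0, 1), so the two connected images meet. *)
exists (rational_circle false 1); split; first exact: imageT.
exists 1 => //; apply: circle_eq => //; rewrite !re_pt.
by rewrite expr1n subrr !mulr0 !mul0r.
Qed.

(** * Continuity and surjectivity of squaring *)

Lemma continuous_circle_sq : continuous (@circle_sq R).
Proof.
have [cr ci] := (continuous_re, continuous_im).
apply: continuous_to_circle.
  by apply: continuous_sub; exact: continuous_mul.
apply: continuous_mul; last exact: ci.
by apply: continuous_mul; [exact: cst_continuous|exact: cr].
Qed.

Lemma circle_sq_surj w : exists z, circle_sq z = w.
Proof.
have wn := circle_norm w; have i2 : 0 <= im w ^+ 2 by exact: sqr_ge0.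
have p1 : 0 <= (1 + re w) / 2 by nra.
have p2 : 0 <= (1 - re w) / 2 by nra.
(* Half-angle formulas for the square root with nonnegative real part; [b] carries the sign of
   [im w] so that 2ab comes out as [im w]. *)
pose a := Num.sqrt ((1 + re w) / 2).
pose b := (-1) ^+ (im w < 0)%R * Num.sqrt ((1 - re w) / 2).
have a2 : a ^+ 2 = (1 + re w) / 2 by rewrite sqr_sqrtr.
have b2 : b ^+ 2 = (1 - re w) / 2.
  by rewrite exprMn sqrr_sign mul1r sqr_sqrtr.
have ab : unit_circle R (a, b) by rewrite /unit_circle/= a2 b2; field.
exists (circle_pt ab); apply: circle_eq.
  by rewrite re_sq re_pt im_pt a2 b2; field.
rewrite im_sq re_pt im_pt.
(* On the unit circle the two radicands multiply to (im w / 2)^2, so the product of the roots is |im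
   w| / 2. *)
transitivity ((-1) ^+ (im w < 0)%R * (2 * Num.sqrt ((im w / 2) ^+ 2))).
  have -> : (im w / 2) ^+ 2 = (1 + re w) / 2 * ((1 - re w) / 2).
    by rewrite expr_div_n (_ : im w ^+ 2 = 1 - re w ^+ 2); [field|lra].
  by rewrite sqrtrM// /a /b; ring.
rewrite sqrtr_sqr normrM [`|2^-1|]ger0_norm ?invr_ge0//.
by rewrite [`|_| * _]mulrC mulVKf ?pnatr_eq0// -realEsign ?num_real.
Qed.

(** * Local trivialisations of squaring *)

Definition dot z w : R := re z * re w + im z * im w.

Lemma continuous_dot w : continuous (dot ^~ w).
Proof.
apply: continuous_add; apply: continuous_mul; try exact: cst_continuous.
  exact: continuous_re.
exact: continuous_im.
Qed.

(* Both sides are |z0 + z^2 * conj z0|^2. *)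
Lemma dot_sq z z0 :
  2 + 2 * dot (circle_sq z) (circle_sq z0) = (2 * dot z z0) ^+ 2.
Proof.
rewrite /dot !re_sq !im_sq.
transitivity (2 * ((re z ^+ 2 + im z ^+ 2) * (re z0 ^+ 2 + im z0 ^+ 2)) + 2 *
 ((re z ^+ 2 - im z ^+ 2) * (re z0 ^+ 2 - im z0 ^+ 2) +
    2 * re z * im z * (2 * re z0 * im z0))); last by ring.
by rewrite !circle_norm !mulr1.
Qed.

Section Chart.
Variable z0 : circle R.

(** The circle without the antipode of z0^2. *)
Definition chart : set (circle R) := [set w | -1 < dot w (circle_sq z0)].

(** If the product vanished, [dot_sq] would give the squares inner product -1. Hence the sign of
    [dot z z0] separates the two square roots of any point of the chart. *)
Lemma chart_dot_neq0 z : chart (circle_sq z) -> dot z z0 != 0.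
Proof.
rewrite /chart/= => Vz; apply/eqP => d0; have := dot_sq z z0.
by rewrite d0 mulr0 expr0n/=; lra.
Qed.

(* +-(z0 + w * conj z0) / |z0 + w * conj z0|: if w = z^2, then
   z0 + w * conj z0 = 2 (dot z z0) z. *)
Definition scale b w : R :=
  (if b then 1 else -1) / Num.sqrt (2 + 2 * dot w (circle_sq z0)).
Definition root_re b w := scale b w * (re z0 + (re w * re z0 + im w * im z0)).
Definition root_im b w := scale b w * (im z0 + (im w * re z0 - re w * im z0)).

(** By [dot_sq] the denominator of [scale] is |2 dot z z0|, so only a sign survives: it is -1
    exactly when [b] disagrees with the sign of [dot z z0]. *)
Lemma scale_sq b z : chart (circle_sq z) ->
  scale b (circle_sq z) * (2 * dot z z0) = (-1) ^+ (b != (0 < dot z z0)%R).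
Proof.
move=> /chart_dot_neq0 d0; rewrite /scale dot_sq sqrtr_sqr normrM.
rewrite [`|2|]ger0_norm//.
have [dp|dn|d0'] := ltrgt0P (dot z z0); last by rewrite d0' eqxx in d0.
  by case: b; rewrite ?expr0 ?expr1; field.
by case: b; rewrite ?expr0 ?expr1; field; rewrite ?oppr_eq0.
Qed.

Lemma root_re_sq b z : chart (circle_sq z) ->
  root_re b (circle_sq z) = (-1) ^+ (b != (0 < dot z z0)%R) * re z.
Proof.
move=> Vz; rewrite -(scale_sq b Vz) -[RHS]mulrA; congr (scale b _ * _).
by have zn := circle_norm_im z; rewrite re_sq im_sq /dot; ring: zn.
Qed.

Lemma root_im_sq b z : chart (circle_sq z) ->
  root_im b (circle_sq z) = (-1) ^+ (b != (0 < dot z z0)%R) * im z.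
Proof.
move=> Vz; rewrite -(scale_sq b Vz) -[RHS]mulrA; congr (scale b _ * _).
by have zn := circle_norm_im z; rewrite re_sq im_sq /dot; ring: zn.
Qed.

Lemma root_subproof (y : chart * bool) :
  unit_circle R (root_re y.2 (set_val y.1), root_im y.2 (set_val y.1)).
Proof.
case: y => y b /=; have [z zy] := circle_sq_surj (set_val y).
have Vz : chart (circle_sq z) by rewrite zy; have := set_valP y; rewrite -set_valE.
rewrite /unit_circle/= -zy root_re_sq// root_im_sq//.
by rewrite !exprMn sqrr_sign !mul1r circle_norm.
Qed.

Definition root_pt (y : chart * bool) : circle R :=
  circle_pt (root_subproof y).

(** For any square root [z] of the base point, [root_pt] is [z] or [-z], whichever makes the inner
    product with [z0] positive exactly when [b] holds. *)
Lemma root_ptP (y : chart * bool) :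
  circle_sq (root_pt y) = set_val y.1 /\ (0 < dot (root_pt y) z0) = y.2.
Proof.
case: y => y b; have [z zy] := circle_sq_surj (set_val y).
have Vz : chart (circle_sq z) by rewrite zy; have := set_valP y; rewrite -set_valE.
have rE : re (root_pt (y, b)) = (-1) ^+ (b != (0 < dot z z0)%R) * re z.
  by rewrite re_pt -zy root_re_sq.
have iE : im (root_pt (y, b)) = (-1) ^+ (b != (0 < dot z z0)%R) * im z.
  by rewrite im_pt -zy root_im_sq.
split.
  rewrite -[RHS]zy; apply: circle_eq; rewrite ?re_sq ?im_sq rE iE.
    by rewrite !exprMn sqrr_sign !mul1r.
  by move: ((-1) ^+ _) (sqrr_sign R (b != (0 < dot z z0))) => e e1; ring: e1.
rewrite /dot rE iE -!mulrA -mulrDr -/(dot z z0) [RHS]/=.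
have := chart_dot_neq0 Vz.
have [dp|dn|->] := ltrgt0P (dot z z0); rewrite ?eqxx// => _; case: b {rE iE} => /=.
- by rewrite expr0 mul1r.
- by rewrite expr1; apply/negbTE; rewrite -leNgt; lra.
- by rewrite expr1; lra.
- by rewrite expr0 mul1r; apply/negbTE; rewrite -leNgt; lra.
Qed.

Lemma continuous_root_pt : continuous root_pt.
Proof.
have cw : continuous (fun y : chart * bool => set_val y.1).
  move=> y; apply: (@continuous_comp _ _ _ fst (set_val : chart -> _)).
    exact: continuous_fst.
  exact: continuous_set_val.
have cr : continuous (fun y : chart * bool => re (set_val y.1)).
  by move=> y; exact: continuous_comp (cw y) (@continuous_re _).
have ci : continuous (fun y : chart * bool => im (set_val y.1)).
  by move=> y; exact: continuous_comp (cw y) (@continuous_im _).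
have csc : continuous (fun y : chart * bool => scale y.2 (set_val y.1)).
  apply: continuous_mul.
    pose sgn (b : bool) : R := if b then 1 else -1.
    have csgn : continuous sgn.
      move=> b A /nbhs_singleton Ab.
      by apply: (filterS _ (discrete_set1 b)) => _ ->.
    by move=> y; exact: continuous_comp (@continuous_snd _ _ y) (csgn _).
  (* On the chart the inner product exceeds -1, so the radicand is positive and the denominator does
     not vanish. *)
  apply: continuous_inv => [y|].
    have := set_valP y.1; rewrite -set_valE /chart/= => Vy.
    by apply: lt0r_neq0; rewrite sqrtr_gt0; lra.
  pose n2 (y : chart * bool) := 2 + 2 * dot (set_val y.1) (circle_sq z0).
  have cn : continuous n2.
    apply: continuous_add; first exact: cst_continuous.
    apply: continuous_mul; first exact: cst_continuous.
    by move=> y; exact: continuous_comp (cw y) (@continuous_dot _ _).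
  by move=> y; exact: continuous_comp (cn y) (@sqrt_continuous R _).
apply: continuous_to_circle; apply: continuous_mul; try exact: csc.
  apply: continuous_add; first exact: cst_continuous.
  by apply: continuous_add; apply: continuous_mul => //; exact: cst_continuous.
apply: continuous_add; first exact: cst_continuous.
by apply: continuous_sub; apply: continuous_mul => //; exact: cst_continuous.
Qed.

Lemma chart_open : open chart.
Proof.
have /continuousP cd := @continuous_dot (circle_sq z0).
exact: cd (@open_gt _ (-1)).
Qed.

(** The fibre is [bool]: a point is recorded by its square and by the side of the line orthogonal to
    [z0] on which it lies; [root_pt] recovers it. *)
Lemma circle_sq_trivial_over :
  trivial_over (@circle_sq R) (@circle_sq R @^-1` chart) chart.
Proof.
have Vd (d : @circle_sq R @^-1` chart) : chart (circle_sq (set_val d)).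
  by have := set_valP d; rewrite -set_valE.
pose q (d : @circle_sq R @^-1` chart) : chart := set_point _ (Vd d).
have gV (y : chart * bool) : (@circle_sq R @^-1` chart) (root_pt y).
  rewrite /preimage/= (root_ptP y).1.
  by have := set_valP y.1; rewrite -set_valE.
exists bool, (fun d => (q d, 0 < dot (set_val d) z0)); split => //.
exists (fun y => set_point _ (gV y)); split.
- move=> d; apply: set_val_inj; apply: circle_eq.
    by rewrite re_pt root_re_sq// eqxx mul1r.
  by rewrite im_pt root_im_sq// eqxx mul1r.
- move=> y; have [y1 y2] := root_ptP y.
  rewrite [RHS]surjective_pairing; congr pair => //.
  exact: set_val_inj.
- apply: continuous_pair.
    apply: (continuous_set_val_factor (f := q)) => d.
    apply: (@continuous_comp _ _ _ set_val (@circle_sq R)).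
      exact: continuous_set_val.
    exact: continuous_circle_sq.
  apply: continuous_positive => [d|d]; first exact: chart_dot_neq0.
  apply: (@continuous_comp _ _ _ set_val (dot ^~ z0)).
    exact: continuous_set_val.
  exact: continuous_dot.
- apply: continuous_set_val_factor; exact: continuous_root_pt.
Qed.

End Chart.

Lemma circle_sq_covering : covering_map (@circle_sq R).
Proof.
split; [exact: continuous_circle_sq|exact: circle_sq_surj|move=> w].
have [z0 <-] := circle_sq_surj w.
exists [set w | -1 < dot w (circle_sq z0)]; split.
- exact: chart_open.
- by rewrite /= /dot -!expr2 circle_norm; lra.
- exact: circle_sq_trivial_over.
Qed.

(** * Nontriviality of squaring *)

Lemma pm_one_subproof b : unit_circle R ((-1) ^+ b, 0).
Proof. by rewrite /unit_circle/= sqrr_sign expr0n addr0. Qed.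

Definition pm_one b : circle R := circle_pt (pm_one_subproof b).

(** The total space is connected, so triviality would force injectivity, yet 1 and -1 have the same
    square. *)
Lemma circle_sq_nontrivial : nontrivial_covering (@circle_sq R).
Proof.
apply/(nontrivial_covering_connected _ connected_circle).
  by exists (pm_one false).
move=> /(trivial_covering_inj connected_circle)/(_ (pm_one false) (pm_one true)).
have -> : circle_sq (pm_one false) = circle_sq (pm_one true).
  by apply: circle_eq; rewrite ?re_sq ?im_sq !re_pt !im_pt ?sqrr_sign ?mulr0.
move=> /(_ erefl)/(congr1 re); rewrite !re_pt expr0 expr1; lra.
Qed.

End Circle.

Theorem lemma3p1 (R : realType) :
  (forall (E : topologicalType) (p : E -> circle R),
     covering_map p -> nontrivial_covering p ->
     internally_inhabited (section_sheaf p) /\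
     ~ inhabited (global_element (section_sheaf p))) /\
  (covering_map (@circle_sq R) /\ nontrivial_covering (@circle_sq R)).
Proof.
split=> [E p cp np|]; last first.
  by split; [exact: circle_sq_covering|exact: circle_sq_nontrivial].
split; first exact: covering_internally_inhabited.
apply: nontrivial_no_global_element => //; last exact: connected_circle.
exact: (inhabits (rational_circle false 0)).
Qed.
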